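(* Let $\Gamma$ be a finite, simple, undirected, connected graph with vertex weight $f:V(\Gamma)\to(0,+\infty)$. Let $v\in V(\Gamma)$, let $\Gamma_v=(\{v\};\emptyset)$ be the subgraph consisting of the single vertex $v$, and let $\Gamma_v^c=(V(\Gamma)\setminus\{v\};E(\Gamma)\setminus\partial\Gamma_v)$ be its complement subgraph. Suppose that $\{\Gamma_v,\Gamma_v^c\}$ is a $2$-partition of $\Gamma$, and let positive edge weights $g_0:E(\Gamma)\setminus\partial\Gamma_v\to(0,+\infty)$ be given. Then there exist $\bar\varepsilon>0$ and $\bar\lambda\in[0,1)$ such that for every edge weight $g:E(\Gamma)\to(0,+\infty)$ with $g=g_0$ on $E(\Gamma)\setminus\partial\Gamma_v$ and $$\sum_{e\in\partial\Gamma_v}g(e)\le\bar\varepsilon,$$ and for every $\lambda\in(\bar\lambda,1]$, $\{\Gamma_v,\Gamma_v^c\}$ is the minimal $2$-partition of $\mathcal{F}_\lambda$, i.e. the unique minimizer of $\mathcal{F}_\lambda$ (defined in the context) among all $2$-partitions of $\Gamma$, up to removing edges of $\Gamma_v^c$ which do not disconnect it.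
   Context: A subgraph $\Gamma_k$ of $\Gamma$ is a graph with $V(\Gamma_k)\subseteq V(\Gamma)$ and $E(\Gamma_k)\subseteq E(\Gamma)$; its boundary is $\partial\Gamma_k=\{e_{i,j}\in E(\Gamma): v_i\in V(\Gamma_k),\ v_j\notin V(\Gamma_k)\}$, where $e_{i,j}=e_{j,i}$ is the edge joining $v_i$ and $v_j$. In particular $\partial\Gamma_v$ is the set of edges incident to $v$. An $N$-partition of $\Gamma$ (here $N=2$) is a family $\{\Gamma_k\}_{k=1}^N$ of $N$ connected (nonempty) subgraphs of $\Gamma$ with $\bigcup_k V(\Gamma_k)=V(\Gamma)$ and $V(\Gamma_k)\cap V(\Gamma_h)=\emptyset$ for $k\ne h$. Its cut set is $\mathcal{C}(\{\Gamma_k\})=\bigcup_k\partial\Gamma_k$. For a graph $G$ with vertices in $V(\Gamma)$, its mass is $M(G)=\sum_{w\in V(G)}f(w)$. Given $g:E(\Gamma)\to(0,+\infty)$, set $$P(\{\Gamma_k\})=\sum_{e\in\mathcal{C}(\{\Gamma_k\})}g(e),\qquad \sigma(\{\Gamma_k\})=\sqrt{\sum_{k=1}^N\left(M(\Gamma_k)-\frac{M(\Gamma)}{N}\right)^2},$$ and for $\lambda\in[0,1]$ $$\mathcal{F}_\lambda(\{\Gamma_k\})=\lambda P(\{\Gamma_k\})+(1-\lambda)\sigma(\{\Gamma_k\}).$$ The value $\mathcal{F}_\lambda(\{\Gamma_k\})$ depends only on the vertex sets $\{V(\Gamma_k)\}$, so uniqueness ''up to removing edges of $\Gamma_v^c$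 which do not disconnect it'' means that every minimizing $2$-partition has vertex sets $\{v\}$ and $V(\Gamma)\setminus\{v\}$. *)

(* Defs.v *)
From HB Require Import structures.
From mathcomp Require Import all_boot all_order all_algebra.
From mathcomp Require Import reals.

Set Implicit Arguments.
Unset Strict Implicit.
Unset Printing Implicit Defensive.

Import Order.TTheory GRing.Theory Num.Theory.
Local Open Scope ring_scope.

(* A graph with vertices in the finite ambient type [T]; the edge joining [x]
   and [y] is the unordered pair [set x; y]. *)
Record graph (T : finType) := Graph {
  vset : {set T};
  eset : {set {set T}};
  edgeP : {in eset, forall e : {set T}, #|e| = 2%N /\ e \subset vset}
}.

Section Graphs.
Variable T : finType.
Implicit Types (Gamma G H : graph T) (v x y : T).

Definition adj G : rel T := [rel x y | [set x; y] \in eset G].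

Definition graph_connected G : Prop :=
  vset G != set0 /\ {in vset G &, forall x y, connect (adj G) x y}.

Definition subgraph H G : Prop :=
  vset H \subset vset G /\ eset H \subset eset G.

Definition boundary Gamma H : {set {set T}} :=
  eset Gamma :&: [set [set x; y] | x in vset H, y in ~: vset H].

Fact vertex_graph_edgeP v :
  {in (set0 : {set {set T}}), forall e : {set T}, #|e| = 2%N /\ e \subset [set v]}.
Proof. by move=> e; rewrite inE. Qed.

Definition vertex_graph v : graph T := Graph (@vertex_graph_edgeP v).

Fact vertex_compl_edgeP Gamma v :
  {in eset Gamma :\: boundary Gamma (vertex_graph v),
    forall e : {set T}, #|e| = 2%N /\ e \subset vset Gamma :\ v}.
Proof.
move=> e /setDP[eG eNb]; have [e2 eV] := edgeP eG; split=> //.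
rewrite subsetD1 eV /=; apply: contra eNb => ve.
rewrite inE eG /=; have /eqP/cards2P[x [y [xy def_e]]] := e2.
move: ve; rewrite def_e => /set2P[->|->]; last rewrite setUC.
  by apply: imset2_f; rewrite !inE // eq_sym.
by apply: imset2_f; rewrite !inE.
Qed.

Definition vertex_compl Gamma v : graph T := Graph (@vertex_compl_edgeP Gamma v).

Definition graph_partition (N : nat) Gamma (G : 'I_N -> graph T) : Prop :=
  [/\ forall k, subgraph (G k) Gamma,
      forall k, graph_connected (G k),
      \bigcup_(k < N) vset (G k) = vset Gamma
    & forall k h, k != h -> vset (G k) :&: vset (G h) = set0].

Definition cutset (N : nat) Gamma (G : 'I_N -> graph T) : {set {set T}} :=
  \bigcup_(k < N) boundary Gamma (G k).

Definition graph_pair G H : 'I_2 -> graph T :=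
  fun k => if k == ord0 then G else H.

End Graphs.

Section Functional.
Variables (R : realType) (T : finType).
Implicit Types (Gamma : graph T) (f : T -> R) (g : {set T} -> R).

(* Weights are total functions; only the values of [f] on [vset Gamma] and of
   [g] on [eset Gamma] matter. *)
Definition mass f (G : graph T) : R := \sum_(w in vset G) f w.

Definition cut_weight Gamma g (N : nat) (G : 'I_N -> graph T) : R :=
  \sum_(e in cutset Gamma G) g e.

Definition mass_dev Gamma f (N : nat) (G : 'I_N -> graph T) : R :=
  Num.sqrt (\sum_(k < N) (mass f (G k) - mass f Gamma / N%:R) ^+ 2).

Definition functional Gamma f g (lam : R) (N : nat) (G : 'I_N -> graph T) : R :=
  lam * cut_weight Gamma g G + (1 - lam) * mass_dev Gamma f G.

Definition minimal_partition Gamma f g (lam : R) (N : nat)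
    (G : 'I_N -> graph T) : Prop :=
  graph_partition Gamma G /\
  forall H : 'I_N -> graph T, graph_partition Gamma H ->
    functional Gamma f g lam G <= functional Gamma f g lam H.

End Functional.

(* Main.v *)
Require Import Defs.
From HB Require Import structures.
From mathcomp Require Import all_boot all_order all_fingroup all_algebra.
From mathcomp Require Import reals lra.

Set Implicit Arguments.
Unset Strict Implicit.
Unset Printing Implicit Defensive.

Import Order.TTheory GRing.Theory Num.Theory.
Local Open Scope ring_scope.

(** A [2]-partition whose vertex sets are not [{v}] and [V \ v] splits [V \ v]
   itself, and since [Gamma_v^c] is connected it must cut an edge not incident
   to [v] ([partition_cuts_off_vertex]).  The weight of such an edge is one of
   the given values of [g0], hence at least a constant [m > 0] that does not
   depend on [g].  The cut set of [{Gamma_v, Gamma_v^c}] is the boundary of [v]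
   ([cutset_vertex_pair]), of weight at most [m / 2] once [eps = m / 2].  So at
   [lambda = 1] there is a gap of at least [m / 2] between
   [{Gamma_v, Gamma_v^c}] and every competitor.  The deviation [S] of
   [{Gamma_v, Gamma_v^c}] is also independent of [g], and the deviation of a
   competitor is nonnegative, so the gap survives as long as
   [(1 - lambda) * S < lambda * (m / 2)], that is, for
   [lambda > S / (S + m / 2)].

   The remaining partitions have vertex sets [{v}] and [V \ v] in some order;
   they give the functional the same value, since it only sees the vertex sets
   and is symmetric in the parts ([functional_perm]). *)

Section Cuts.
Variable T : finType.
Implicit Types (Gamma : graph T) (v x y : T) (A : {set T}).

Lemma connect_exit (e : rel T) A x y :
  connect e x y -> x \in A -> y \notin A ->
  exists a b, [/\ a \in A, b \notin A & e a b].
Proof.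
case/connectP=> p; elim: p x => [|z p IHp] x /=; first by move=> _ -> ->.
case/andP=> exz pz lastp xA yNA.
by have [/IHp|zNA] := boolP (z \in A); [apply | exists x, z].
Qed.

Lemma mem_boundary Gamma (H : graph T) x y :
  x \in vset H -> y \notin vset H -> [set x; y] \in eset Gamma ->
  [set x; y] \in boundary Gamma H.
Proof. by move=> xH yH xyG; rewrite inE xyG; apply: imset2_f; rewrite ?inE. Qed.

Lemma cutset_perm Gamma N (s : {perm 'I_N}) (G H : 'I_N -> graph T) :
  (forall k, vset (G k) = vset (H (s k))) -> cutset Gamma G = cutset Gamma H.
Proof.
move=> GH; rewrite /cutset [RHS](reindex_perm s) /=.
by apply: eq_bigr => k _; rewrite /boundary GH.
Qed.

(** An edge leaving [V \ v] has its other end in [V], so that end is [v]: the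
   two parts have the same boundary. *)
Lemma cutset_vertex_pair Gamma v :
  cutset Gamma (graph_pair (vertex_graph v) (vertex_compl Gamma v)) =
  boundary Gamma (vertex_graph v).
Proof.
rewrite /cutset !big_ord_recl big_ord0 setU0 /graph_pair /=.
apply/setUidPl/subsetP=> e /setIP[eG /imset2P[x y]].
move=> /setD1P[xv xV]; rewrite in_setC in_setD1 negb_and negbK => yNV def_e.
rewrite def_e setUC in eG *.
have [_ /subsetP xyV] := edgeP eG.
have yV : y \in vset Gamma by apply: xyV; rewrite !inE eqxx.
have {yNV} yv : y = v by move: yNV; rewrite yV orbF => /eqP.
by apply: mem_boundary => //=; rewrite inE ?yv.
Qed.

(** The part of [v] contains another vertex [w], and some other part contains a
   vertex [b].  A path from [w] to [b] in [Gamma_v^c] has to leave the part of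
   [v], through an edge that does not touch [v]. *)
Lemma partition_cuts_off_vertex Gamma v N (H : 'I_N -> graph T) (k h : 'I_N) :
  graph_connected (vertex_compl Gamma v) -> graph_partition Gamma H ->
  k != h -> v \in vset (H k) -> vset (H k) != [set v] ->
  exists2 e, e \in cutset Gamma H &
             e \in eset Gamma :\: boundary Gamma (vertex_graph v).
Proof.
move=> [_ conn] [sub Hconn _ disj] kh vk; rewrite eqEsubset sub1set vk andbT.
case/subsetPn=> w wk; rewrite inE => wv.
have [/set0Pn[b bh] _] := Hconn h.
have bNk : b \notin vset (H k).
  by apply/negP=> bk; have := in_set0 b; rewrite -(disj k h kh) inE bk bh.
have bv : b != v by apply: contraNneq bNk => ->.
have VH i x : x \in vset (H i) -> x \in vset Gamma.
  by have [/subsetP + _] := sub i; apply.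
have wb : connect (adj (vertex_compl Gamma v)) w b.
  by apply: conn; rewrite /= !inE ?wv ?bv (VH _ _ wk, VH _ _ bh).
have [x [y [xk yNk xy]]] := connect_exit wb wk bNk.
exists [set x; y] => //.
apply/bigcupP; exists k => //; apply: mem_boundary => //.
by move: xy; rewrite /adj /= !inE => /andP[].
Qed.

Lemma vertex_partition_perm Gamma v (H : 'I_2 -> graph T) (k : 'I_2) :
  graph_partition Gamma H -> vset (H k) = [set v] ->
  exists s : {perm 'I_2}, forall i, vset (H i) =
    vset (graph_pair (vertex_graph v) (vertex_compl Gamma v) (s i)).
Proof.
move=> [_ _ cover disj] Hk; exists (tperm ord0 k) => i.
have [->|ik] := eqVneq i k; first by rewrite tpermR.
rewrite /graph_pair (can2_eq (tpermK _ _) (tpermK _ _)) tpermL (negPf ik) /=.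
have vNi : v \notin vset (H i).
  apply/negP=> vi; have := in_set0 v.
  by rewrite -(disj i k ik) inE vi Hk set11.
apply/setP=> x; rewrite !inE -cover.
apply/idP/andP=> [xi | [xv /bigcupP[j _ xj]]].
  by split; [apply: contraNneq vNi => <- | apply/bigcupP; exists i].
have jk : j != k by apply: contraNneq xv => jk; rewrite -in_set1 -Hk -jk.
suff -> : i = j by [].
apply/val_inj; move: ik jk; rewrite -!val_eqE /=.
by case: i {vNi} => [[|[]]] //; case: j {xj} => [[|[]]] //; case: k {Hk} => [[|[]]].
Qed.

Lemma vset_pair_image Gamma v (s : {perm 'I_2}) :
  [set vset (graph_pair (vertex_graph v) (vertex_compl Gamma v) (s k))
    | k : 'I_2] = [set [set v]; vset Gamma :\ v].
Proof.
apply/setP=> A; rewrite !inE; apply/imsetP/orP=> [[k _ ->]|].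
  by rewrite /graph_pair; case: ifP => _ /=; rewrite eqxx; [left | right].
case=> /eqP ->; [exists ((s^-1)%g ord0) | exists ((s^-1)%g ord_max)];
  by rewrite ?permKV.
Qed.

End Cuts.

Section Weights.
Variables (R : realType) (T : finType) (Gamma : graph T).
Variables (f : T -> R) (g : {set T} -> R).

Lemma functional_perm (lam : R) N (s : {perm 'I_N}) (G H : 'I_N -> graph T) :
  (forall k, vset (G k) = vset (H (s k))) ->
  functional Gamma f g lam G = functional Gamma f g lam H.
Proof.
move=> GH; rewrite /functional /cut_weight (cutset_perm Gamma GH).
congr (_ + _ * Num.sqrt _); rewrite [RHS](reindex_perm s) /=.
by apply: eq_bigr => k _; rewrite /mass GH.
Qed.

Lemma cut_weight_ge N (H : 'I_N -> graph T) e :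
  {in eset Gamma, forall e, 0 < g e} -> e \in cutset Gamma H ->
  g e <= cut_weight Gamma g H.
Proof.
move=> g_gt0 eH; rewrite /cut_weight (bigD1 e) //= lerDl.
apply: sumr_ge0 => e' /andP[/bigcupP[k _ /setIP[e'G _]] _].
exact/ltW/g_gt0.
Qed.

End Weights.

Theorem theorem3p5 (R : realType) (T : finType) (Gamma : graph T)
    (f : T -> R) (v : T) (g0 : {set T} -> R) :
  graph_connected Gamma ->
  {in vset Gamma, forall w, 0 < f w} ->
  v \in vset Gamma ->
  graph_partition Gamma (graph_pair (vertex_graph v) (vertex_compl Gamma v)) ->
  {in eset Gamma :\: boundary Gamma (vertex_graph v), forall e, 0 < g0 e} ->
  exists eps lam0 : R,
    [/\ 0 < eps, 0 <= lam0 < 1 &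
      forall g : {set T} -> R,
        {in eset Gamma, forall e, 0 < g e} ->
        {in eset Gamma :\: boundary Gamma (vertex_graph v),
          forall e, g e = g0 e} ->
        \sum_(e in boundary Gamma (vertex_graph v)) g e <= eps ->
        forall lam : R, lam0 < lam <= 1 ->
          minimal_partition Gamma f g lam
            (graph_pair (vertex_graph v) (vertex_compl Gamma v)) /\
          (forall G : 'I_2 -> graph T,
            minimal_partition Gamma f g lam G ->
            [set vset (G k) | k : 'I_2] = [set [set v]; vset Gamma :\ v])].
Proof.
move=> _ _ vV part0 g0_gt0.
set D := _ :\: _ in g0_gt0 *; set P0 := graph_pair _ _ in part0 *.
have conn0 : graph_connected (vertex_compl Gamma v).
  by case: part0 => _ /(_ ord_max).
(* Starting the minimum at [1] covers the case where all edges meet [v]. *)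
pose m : R := \big[Order.min/1]_(e in D) g0 e.
have m_gt0 : 0 < m by apply: lt_bigmin.
pose S := mass_dev Gamma f P0; have S_ge0 : 0 <= S by apply: sqrtr_ge0.
have Sm_gt0 : 0 < S + m / 2 by lra.
exists (m / 2), (S / (S + m / 2)); split; first lra.
  by rewrite divr_ge0 ?(ltW Sm_gt0) //= ltr_pdivrMr //; lra.
move=> g g_gt0 gg0 g_le lam; rewrite ltr_pdivrMr // => /andP[lam_gt lam_le1].
have lam_ge0 : 0 <= lam by rewrite -(pmulr_lge0 _ Sm_gt0); lra.
have gap H : graph_partition Gamma H ->
    (exists s : {perm 'I_2}, forall i, vset (H i) = vset (P0 (s i))) \/
    functional Gamma f g lam P0 < functional Gamma f g lam H.
  move=> partH; have /bigcupP[k _ vk] : v \in \bigcup_(k < 2) vset (H k).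
    by case: partH => _ _ ->.
  have [Hk|Hk] := eqVneq (vset (H k)) [set v].
    by left; apply: vertex_partition_perm partH Hk.
  right; have [h kh] : exists h : 'I_2, k != h.
    by exists (rev_ord k); case: k {vk Hk} => [[|[]]].
  have [e eH eD] := partition_cuts_off_vertex conn0 partH kh vk Hk.
  have m_le : m <= cut_weight Gamma g H.
    apply: le_trans (cut_weight_ge g_gt0 eH).
    by rewrite gg0 //; apply: bigmin_le_cond.
  have P0_le : cut_weight Gamma g P0 <= m / 2.
    by rewrite /cut_weight cutset_vertex_pair.
  have devH_ge0 : 0 <= mass_dev Gamma f H by apply: sqrtr_ge0.
  by rewrite /functional -/S; nra.
split.
  split=> // H /gap[[s sH]|/ltW//].
  by rewrite (functional_perm Gamma f g lam sH).
move=> G [partG minG]; have [[s sG]|] := gap G partG; last first.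
  by rewrite ltNge minG.
by rewrite (eq_imset _ sG) vset_pair_image.
Qed.
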